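(* Let $G=(V,E)$ be a graph, $S$ a multiset of vertices of $V$, $k\in\mathbb{Z}_+$, $f,g:V\to\mathbb{Z}_+$ functions, and $\mathsf{M}=(S,r_{\mathsf{M}})$ a matroid. There exists an $\mathsf{M}$-based $(f,g)$-bounded packing of $k$ rooted trees in $G$ if and only if all of the following hold: (i) $f(v)\le\min\{r_{\mathsf{M}}(S_v),g(v)\}$ for every $v\in V$; (ii) $k\le\sum_{v\in V}\min\{r_{\mathsf{M}}(S_v),g(v)\}$; (iii) $e_E(\mathcal{P})\ge\sum_{X\in\mathcal{P}}\max\{r_{\mathsf{M}}(S)-r_{\mathsf{M}}(S_Y)-g(X\setminus Y):Y\subseteq X\}$ for every partition $\mathcal{P}$ of $V$; (iv) $e_E(\mathcal{P})+k\ge\sum_{X\in\mathcal{P}}\max\{r_{\mathsf{M}}(S)-r_{\mathsf{M}}(S_Y)+f(Y):Y\subseteq X\}$ for every partition $\mathcal{P}$ of $V$.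
   Context: $\mathbb{Z}_+$ is the set of non-negative integers; for $h:V\to\mathbb{Z}$ and $X\subseteq V$, $h(X)=\sum_{x\in X}h(x)$. A multiset $S$ of vertices is a finite collection of vertices with multiplicities; for $X\subseteq V$, $S_X$ is the set of elements of $S$ located in $X$, $S_v=S_{\{v\}}$, and $r_{\mathsf{M}}$ is the rank function of $\mathsf{M}$ (with $r_{\mathsf{M}}(\emptyset)=0$). $e_E(\mathcal{P})$ is the number of edges of $E$ joining different members of the partition $\mathcal{P}$. A rooted tree is a tree of $G$ (possibly a single vertex) with a designated root vertex; a packing is a collection of pairwise edge-disjoint rooted trees. The packing is $\mathsf{M}$-based if each tree's root is assigned a distinct element of $S$ located at the root vertex, and for every vertex $v$ of $G$ the set of root-elements of the trees containing $v$ is a basis of $\mathsf{M}$. It is $(f,g)$-bounded if every vertex $v$ is the root of at least $f(v)$ and at most $g(v)$ trees of the packing. A packing of $k$ rooted trees has exactly $k$ trees. *)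

(* Defs.v *)
From mathcomp Require Import all_boot all_order all_algebra.

Set Implicit Arguments.
Unset Strict Implicit.
Unset Printing Implicit Defensive.

(* Finite undirected multigraph: parallel edges and loops are allowed.  The
   order of the two ends of an edge carries no meaning. *)
Record graph (V E : finType) := Graph { ends : E -> V * V }.

Definition joins (V E : finType) (G : graph V E) (e : E) (x y : V) : bool :=
  (ends G e == (x, y)) || (ends G e == (y, x)).

(* The walk x, e1, v1, ..., en, vn is encoded by its origin x and the list
   [:: (e1, v1); ...; (en, vn)]. *)
Fixpoint walk (V E : finType) (G : graph V E) (F : {set E}) (x : V)
    (w : seq (E * V)) : bool :=
  if w is (e, y) :: w' then [&& e \in F, joins G e x y & walk G F y w']
  else true.

(* A loop is a cycle of length 1, two parallel edges form a cycle of length 2;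
   distinctness of the edges excludes going back and forth along one edge. *)
Definition is_cycle (V E : finType) (G : graph V E) (F : {set E}) (x : V)
    (w : seq (E * V)) : bool :=
  [&& w != [::], walk G F x w, last x (unzip2 w) == x,
      uniq (unzip1 w) & uniq (unzip2 w)].

Definition acyclic (V E : finType) (G : graph V E) (F : {set E}) : Prop :=
  forall (x : V) (w : seq (E * V)), ~~ is_cycle G F x w.

Definition adj (V E : finType) (G : graph V E) (F : {set E}) : rel V :=
  fun x y => [exists e in F, joins G e x y].

Definition connected (V E : finType) (G : graph V E) (U : {set V})
    (F : {set E}) : Prop :=
  U != set0 /\ {in U &, forall x y, connect (adj G F) x y}.

Definition is_subgraph (V E : finType) (G : graph V E) (U : {set V})
    (F : {set E}) : Prop :=
  {in F, forall e, ((ends G e).1 \in U) && ((ends G e).2 \in U)}.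

Definition is_tree (V E : finType) (G : graph V E) (U : {set V})
    (F : {set E}) : Prop :=
  [/\ is_subgraph G U F, connected G U F & acyclic G F].

Record rooted_tree (V E : finType) (G : graph V E) := RootedTree {
  tree_verts : {set V};
  tree_edges : {set E};
  tree_root : V;
  _ : is_tree G tree_verts tree_edges;
  _ : tree_root \in tree_verts }.

Record matroid (S : finType) := Matroid {
  rk : {set S} -> nat;
  _ : forall A : {set S}, rk A <= #|A|;
  _ : forall A B : {set S}, A \subset B -> rk A <= rk B;
  _ : forall A B : {set S}, rk (A :|: B) + rk (A :&: B) <= rk A + rk B }.

Definition indep (S : finType) (M : matroid S) (A : {set S}) : bool :=
  rk M A == #|A|.

Definition is_basis (S : finType) (M : matroid S) (B : {set S}) : bool :=
  maxset (indep M) B.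

(* A packing of k rooted trees is an indexed family, so that the same
   one-vertex tree may occur several times. *)
Definition is_packing (V E : finType) (G : graph V E) (k : nat)
    (T : 'I_k -> rooted_tree G) : Prop :=
  forall i j, i != j -> [disjoint tree_edges (T i) & tree_edges (T j)].

(* Here and below, a multiset of vertices is a finite type S of elements with a
   map loc sending each element to the vertex where it is located; S_X is then
   the preimage loc @^-1: X. *)
Definition matroid_based (V E S : finType) (G : graph V E) (loc : S -> V)
    (M : matroid S) (k : nat) (T : 'I_k -> rooted_tree G) : Prop :=
  exists s : 'I_k -> S,
    [/\ injective s,
        forall i, loc (s i) = tree_root (T i)
      & forall v, is_basis M [set s i | i in 'I_k & v \in tree_verts (T i)]].

Definition bounded (V E : finType) (G : graph V E) (f g : V -> nat) (k : nat)
    (T : 'I_k -> rooted_tree G) : Prop :=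
  forall v, f v <= #|[set i | tree_root (T i) == v]| <= g v.

Definition cross_edges (V E : finType) (G : graph V E) (P : {set {set V}}) :
    nat :=
  #|[set e | pblock P (ends G e).1 != pblock P (ends G e).2]|.

Definition vsum (V : finType) (h : V -> nat) (X : {set V}) : nat :=
  \sum_(x in X) h x.

(* max {F Y : Y \subset X}; the default value F set0 is one of the candidates. *)
Definition max_subset (V : finType) (X : {set V}) (F : {set V} -> int) : int :=
  \big[Num.max/F set0]_(Y : {set V} | Y \subset X) F Y.

(* Main.v *)
Require Import Defs.
From mathcomp Require Import all_boot all_order all_algebra.
From mathcomp Require Import zify.

(* Necessity: a tree meeting n blocks of a partition uses at least n - 1 crossing
   edges, so the number of blocks that it meets without being rooted in them,
   summed over the trees, is at most e(P); each block X is met in this way by at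
   least r(S) - r(S_Y) - #(roots in X \ Y) trees.

   Sufficiency: let i(X) be the number of edges inside X.  One first looks for
   vectors m (future in-degrees) and x (future numbers of roots) such that
     i(X) + r(S) <= m(X) + x(X \ Y) + r(S_Y)  for all nonempty X and all Y in X,
   with m(V) = |E|, x(V) = k and f <= x <= min(r(S_v), g).  Tight pairs (X, Y) are
   closed under union and intersection when the sets X meet, so whenever m or x
   cannot be improved any more, the maximal tight sets form a partition of V, for
   which (iii), resp. (iv), gives the bound that is needed.  A minimal subset R of S
   that still satisfies the inequalities with S_Y replaced by R_Y has exactly x(v)
   elements at v, and they are independent.  Finally G has an orientation with
   in-degrees m, in which at least r(S) - r(R_X) arcs enter every nonempty X, and
   the trees are grown arc by arc from the roots R as in the proof of Durand de
   Gevigney, Nguyen and Szigeti for digraphs. *)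

Set Implicit Arguments.
Unset Strict Implicit.
Unset Printing Implicit Defensive.

Import Order.TTheory GRing.Theory Num.Theory.

(** * Reachability and comparison of cardinalities *)

Lemma connect_exit (T : finType) (e : rel T) (P : pred T) (x y : T) :
  connect e x y -> P x -> ~~ P y -> exists a b, [/\ e a b, P a & ~~ P b].
Proof.
case/connectP=> p; elim: p x => [|z p IH] x /= => [_ -> -> //|/andP[exz pz] yE Px Py].
by have [Pz|nPz] := boolP (P z); [apply: IH pz yE Pz Py | exists x, z].
Qed.

(** Reduces sub- and supermodularity of edge counts to a Boolean check at each edge. *)
Lemma leq_cardD (T : finType) (A B C D : {set T}) :
  (forall x, (x \in A) + (x \in B) <= (x \in C) + (x \in D)) ->
  #|A| + #|B| <= #|C| + #|D|.
Proof.
have cE (Z : {set T}) : #|Z| = \sum_x (x \in Z : nat).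
  by rewrite -sum1_card big_mkcond.
by move=> h; rewrite !cE -!big_split; apply: leq_sum => x _; exact: h.
Qed.

(** * Rank, closure and coloops of a matroid *)

Section Rank.
Variables (S : finType) (M : matroid S).
Implicit Types A B C : {set S}.

Lemma rk_card A : rk M A <= #|A|.
Proof. by case: M. Qed.

Lemma rkS A B : A \subset B -> rk M A <= rk M B.
Proof. by case: M => r ? rm ?; exact: rm. Qed.

Lemma rkUI A B : rk M (A :|: B) + rk M (A :&: B) <= rk M A + rk M B.
Proof. by case: M. Qed.

Lemma rk0 : rk M set0 = 0.
Proof. by apply/eqP; rewrite -leqn0 -(cards0 S) rk_card. Qed.

Lemma rkU A B : rk M (A :|: B) <= rk M A + rk M B.
Proof. by have := rkUI A B; lia. Qed.

Lemma rk_U1 s A : rk M (s |: A) <= (rk M A).+1.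
Proof. by have := rkU [set s] A; have := rk_card [set s]; rewrite cards1; lia. Qed.

Definition mclosure A := [set s | rk M (s |: A) <= rk M A].

Lemma sub_mclosure A : A \subset mclosure A.
Proof. by apply/subsetP=> s sA; rewrite inE (setUidPr _) ?sub1set. Qed.

(** One spanned element [s] at a time: [s |: A] and [A :|: B :\ s] have the rank of [A] and meet in
    a superset of [A], so submodularity bounds their union. *)
Lemma rkU_mclosure A B : B \subset mclosure A -> rk M (A :|: B) = rk M A.
Proof.
have [n] := ubnP #|B|; elim: n B => // n IH B cB sB.
have [->|/set0Pn[s Bs]] := eqVneq B set0; first by rewrite setU0.
have IHs : rk M (A :|: B :\ s) = rk M A.
  by apply: IH; [rewrite (cardsD1 s) Bs in cB | apply: subset_trans sB; exact: subsetDl].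
have := subsetP sB s Bs; rewrite inE => cls.
apply/eqP; rewrite eqn_leq [X in _ && X]rkS ?subsetUl // andbT.
have := rkUI (s |: A) (A :|: B :\ s).
have -> : (s |: A) :|: (A :|: B :\ s) = A :|: B.
  by apply/setP=> x; rewrite !inE; case: eqP => [->|]; rewrite ?Bs ?orbT //=; case: (x \in A).
have : rk M A <= rk M ((s |: A) :&: (A :|: B :\ s)).
  by apply: rkS; rewrite subsetI subsetUr subsetUl.
lia.
Qed.

Lemma rk_mclosure A : rk M (mclosure A) = rk M A.
Proof. by have := rkU_mclosure (subxx (mclosure A)); rewrite (setUidPr (sub_mclosure A)). Qed.

Lemma mclosure_sub A B : A \subset mclosure B -> mclosure A \subset mclosure B.
Proof.
move=> sAB; apply/subsetP=> s; rewrite !inE => sA.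
have := rkUI (s |: A) (B :|: A); rewrite (rkU_mclosure sAB).
have : rk M A <= rk M ((s |: A) :&: (B :|: A)).
  by apply: rkS; rewrite subsetI !subsetUr.
have : rk M (s |: B) <= rk M ((s |: A) :|: (B :|: A)).
  by apply: rkS; apply/subsetP=> x; rewrite !inE => /orP[]->; rewrite ?orbT.
lia.
Qed.

Lemma indepS A B : A \subset B -> indep M B -> indep M A.
Proof.
rewrite /indep => sAB /eqP iB; rewrite eqn_leq rk_card /=.
have := rkU A (B :\: A); have := rk_card (B :\: A).
rewrite setDE setUIr setUCr setIT (setUidPr sAB) -setDE cardsD (setIidPr sAB).
by have := subset_leq_card sAB; lia.
Qed.

Lemma indep_U1 s A : indep M A -> s \notin mclosure A -> indep M (s |: A).
Proof.
rewrite /indep inE -ltnNge => /eqP iA; have := rk_card (s |: A).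
by rewrite cardsU1; case: (s \in A) => /=; lia.
Qed.

Lemma indep_full_basis A : indep M A -> rk M setT <= rk M A -> is_basis M A.
Proof.
move=> iA rA; apply/maxsetP; split=> // B iB sAB.
apply/eqP; rewrite eq_sym eqEcard sAB -(eqP iA) -(eqP iB) /=.
by apply: leq_trans rA; apply: rkS.
Qed.

Lemma basis_card A : is_basis M A -> #|A| = rk M setT.
Proof.
case/maxsetP=> iA maxA.
suff cE : mclosure A = setT by rewrite -cE rk_mclosure (eqP iA).
apply/setP=> s; rewrite [RHS]inE; apply/negPn/negP=> ns.
have := maxA _ (indep_U1 iA ns) (subsetUr _ _) => e.
by move: ns; rewrite (subsetP (sub_mclosure A)) // -e setU11.
Qed.

(** Each element of [A] lies in every basis of the restriction of [M] to [B]. *)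
Definition coloops A B := forall s, s \in A -> rk M (B :\ s) < rk M B.

(** By submodularity, deleting [s] costs a smaller set containing [s] at least as much rank as a
    larger one. *)
Lemma coloopsS A B C : A \subset C -> C \subset B -> coloops A B -> coloops A C.
Proof.
move=> sAC sCB clB s As; have := clB s As.
have := rkUI (B :\ s) C.
rewrite setIDAC (setIidPr sCB).
have -> : B :\ s :|: C = B.
  apply/eqP; rewrite eqEsubset subUset subsetDl sCB /=.
  rewrite -{1}(setD1K (subsetP sCB s (subsetP sAC s As))) subUset sub1set.
  by rewrite inE (subsetP sAC) // orbT subsetUl.
lia.
Qed.

(** Each deletion costs a unit of rank and leaves the rest of [A] coloops. *)
Lemma rkD_coloops A B : A \subset B -> coloops A B -> rk M (B :\: A) + #|A| <= rk M B.
Proof.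
have [n] := ubnP #|A|; elim: n A B => // n IH A B cA sAB clAB.
have [->|/set0Pn[s As]] := eqVneq A set0; first by rewrite setD0 cards0 addn0.
have cAE : #|A| = #|A :\ s|.+1 by rewrite (cardsD1 s) As.
have sA' : A :\ s \subset B :\ s by exact: setSD.
have cl' : coloops (A :\ s) (B :\ s).
  move=> t; rewrite !inE => /andP[nts At].
  have := rkUI (B :\ s) (B :\ t); have := clAB t At; have := clAB s As.
  have -> : B :\ s :|: B :\ t = B.
    rewrite -setDIr (_ : _ :&: _ = set0) ?setD0 //.
    by apply/setP=> x; rewrite !inE; case: eqP => // ->; rewrite eq_sym (negbTE nts).
  rewrite -setDUr -setDDl.
  lia.
have := IH _ _ _ sA' cl'; rewrite cAE in cA *.
have -> : (B :\ s) :\: (A :\ s) = B :\: A.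
  by apply/setP=> x; rewrite !inE; case: eqP => [->|//]; rewrite As.
by move=> /(_ cA); have := clAB s As; lia.
Qed.

End Rank.

(** * Sums over vertex sets and partitions into maximal sets *)

Section Vsum.
Variable V : finType.
Implicit Types (X Y : {set V}) (h : V -> nat).

Lemma vsum0 h : vsum h set0 = 0.
Proof. exact: big_set0. Qed.

Lemma vsum1 h v : vsum h [set v] = h v.
Proof. exact: big_set1. Qed.

Lemma vsumT h : vsum h setT = \sum_v h v.
Proof. by apply: eq_bigl => v; rewrite inE. Qed.

Lemma vsumD h X Y : Y \subset X -> vsum h (X :\: Y) + vsum h Y = vsum h X.
Proof. by move=> sYX; rewrite /vsum [RHS](big_setID Y) /= (setIidPr sYX) addnC. Qed.

Lemma vsumUI h X Y : vsum h (X :|: Y) + vsum h (X :&: Y) = vsum h X + vsum h Y.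
Proof.
have := vsumD h (subsetUl X Y); rewrite setDUl setDv set0U => <-.
by have := vsumD h (subsetIr X Y); rewrite setDIr setDv setU0 => <-; lia.
Qed.

Lemma vsumS h X Y : X \subset Y -> vsum h X <= vsum h Y.
Proof. by move/(vsumD h) <-; apply: leq_addl. Qed.

Lemma leq_vsum h1 h2 X : (forall v, v \in X -> h1 v <= h2 v) -> vsum h1 X <= vsum h2 X.
Proof. exact: leq_sum. Qed.

Lemma vsum_incr h a X : vsum (fun v => h v + (v == a)) X = vsum h X + (a \in X).
Proof.
rewrite /vsum big_split; congr (_ + _); rewrite -big_mkcondr sum1_card.
rewrite (eq_card (B := X :&: [set a])) => [|v]; last by rewrite !inE.
have [aX|naX] := boolP (a \in X); first by rewrite (setIidPr _) ?cards1 ?sub1set.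
by apply/eqP; rewrite cards_eq0 setI_eq0 disjoint_sym disjoints1.
Qed.

Lemma vsum_decr h a X : 0 < h a ->
  vsum (fun v => h v - (v == a)) X + (a \in X) = vsum h X.
Proof.
by move=> ha; rewrite -vsum_incr; apply: eq_bigr => v _; case: eqP => [->|_]; lia.
Qed.

(** Two maximal members that meet both equal their union, so distinct ones are disjoint. *)
Lemma partition_of_maximal (t : pred {set V}) :
    (forall X, t X -> X != set0) -> (forall v, exists2 X, t X & v \in X) ->
    (forall X Y, t X -> t Y -> X :&: Y != set0 -> t (X :|: Y)) ->
  exists2 P, partition P [set: V] & {in P, forall X, t X}.
Proof.
move=> t0 tv tU; exists [set X | maxset t X]; last by move=> X; rewrite inE => /maxsetp.
apply/and3P; split.
- apply/eqP/setP=> v; rewrite inE; have [X tX vX] := tv v.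
  by have [Y mY sXY] := maxset_exists tX; apply/bigcupP; exists Y; rewrite ?inE ?(subsetP sXY).
- apply/trivIsetP=> X Y; rewrite !inE => mX mY; apply: contraR; rewrite -setI_eq0 => XY.
  have tXY := tU _ _ (maxsetp mX) (maxsetp mY) XY.
  by rewrite -(maxsetsup mX tXY (subsetUl _ _)) (maxsetsup mY tXY (subsetUr _ _)).
- by apply/negP; rewrite inE => /maxsetp/t0; rewrite eqxx.
Qed.

End Vsum.

(** * Feasible vectors of in-degrees and root numbers *)

Section Vectors.
Variables (V : finType) (i q : {set V} -> nat) (r : nat).
Hypothesis i_supermod : forall X Y, i X + i Y <= i (X :|: Y) + i (X :&: Y).
Hypothesis q_submod : forall X Y, q (X :|: Y) + q (X :&: Y) <= q X + q Y.
Hypothesis q_le : forall X, q X <= r.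
Implicit Types (X Y : {set V}) (m x f : V -> nat).

(** [q] stays abstract: it is the rank of [S_Y] at first, and that of [R_Y] for a subset [R] of [S]
    later. *)
Definition feasible m x := [forall X : {set V}, forall Y : {set V},
  (X != set0) && (Y \subset X) ==> (i X + r <= vsum m X + vsum x (X :\: Y) + q Y)].

Definition tight m x X Y :=
  [&& X != set0, Y \subset X & vsum m X + vsum x (X :\: Y) + q Y == i X + r].

Lemma feasibleP m x : reflect
  (forall X Y, X != set0 -> Y \subset X -> i X + r <= vsum m X + vsum x (X :\: Y) + q Y)
  (feasible m x).
Proof.
apply: (iffP 'forall_forallP) => h X Y; last by apply/implyP=> /andP[]; exact: h.
by move=> X0 sYX; apply: (implyP (h X Y)); rewrite X0.
Qed.

Lemma infeasible m x : ~~ feasible m x -> exists X Y,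
  [/\ X != set0, Y \subset X & vsum m X + vsum x (X :\: Y) + q Y < i X + r].
Proof.
case/forallPn=> X /forallPn[Y]; rewrite negb_imply -ltnNge => /andP[/andP[]].
by exists X, Y.
Qed.

(** Uncrossing: the terms in [m] and [x] are modular, [i] is supermodular and [q] submodular, so the
    slacks of union and intersection add up to at most zero. The sets must meet for the constraint
    on the intersection to apply. *)
Lemma tightUI m x X1 Y1 X2 Y2 : feasible m x ->
    tight m x X1 Y1 -> tight m x X2 Y2 -> X1 :&: X2 != set0 ->
  tight m x (X1 :|: X2) (Y1 :|: Y2) && tight m x (X1 :&: X2) (Y1 :&: Y2).
Proof.
move=> /feasibleP fe /and3P[X10 sY1 /eqP t1] /and3P[X20 sY2 /eqP t2] nI.
have nU : X1 :|: X2 != set0 by rewrite setU_eq0 negb_and X10.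
have sU := setUSS sY1 sY2; have sI := setISS sY1 sY2.
have := fe _ _ nU sU; have := fe _ _ nI sI; rewrite /tight nU nI sU sI /=.
have := vsumD x sY1; have := vsumD x sY2; have := vsumD x sU; have := vsumD x sI.
have := vsumUI x X1 X2; have := vsumUI x Y1 Y2; have := vsumUI m X1 X2.
have := i_supermod X1 X2; have := q_submod Y1 Y2; lia.
Qed.

(** [D] marks vertices that the inner sets [Y] avoid; unions preserve this. *)
Lemma tight_partition m x (D : pred V) : feasible m x ->
    (forall b, exists X Y, [/\ tight m x X Y, b \in X & {in Y, forall v, ~~ D v}]) ->
  exists P (y : {set V} -> {set V}), partition P [set: V] /\
    {in P, forall X, tight m x X (y X) /\ {in y X, forall v, ~~ D v}}.
Proof.
move=> fe cov.
pose t X Y := tight m x X Y && [forall v in Y, ~~ D v].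
have [X|v|X1 X2|P pP tP] := @partition_of_maximal V (fun X => [exists Y, t X Y]).
- by case/existsP=> Y /andP[/and3P[]].
- have [X [Y [tXY vX YD]]] := cov v; exists X => //; apply/existsP; exists Y.
  by rewrite /t tXY; apply/forall_inP.
- case/existsP=> Y1 /andP[t1 /forall_inP D1] /existsP[Y2 /andP[t2 /forall_inP D2]] nI.
  apply/existsP; exists (Y1 :|: Y2); rewrite /t; have /andP[-> _] := tightUI fe t1 t2 nI.
  by apply/forall_inP=> v; rewrite inE => /orP[/D1|/D2].
exists P, (fun X => odflt set0 [pick Y | t X Y]); split=> // X /tP/existsP[Y tXY].
by case: pickP => [Z /andP[tZ /forall_inP]|/(_ Y)]; rewrite ?tXY.
Qed.

Lemma partition_sum P m : partition P [set: V] -> \sum_(X in P) vsum m X = vsum m setT.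
Proof. by move=> pP; rewrite [RHS](set_partition_big _ pP). Qed.

(** A large [m] is lowered while it stays feasible. With [i setT] the number of all edges, the
    hypothesis is (iii) with [x] for [g], the edges inside the blocks being added to both sides; [y]
    picks a subset of each block. *)
Lemma feasible_exists x :
    (forall (P : {set {set V}}) (y : {set V} -> {set V}),
      partition P [set: V] -> {in P, forall X, y X \subset X} ->
      \sum_(X in P) (i X + r) <= i setT + \sum_(X in P) (q (y X) + vsum x (X :\: y X))) ->
  exists2 m, feasible m x & vsum m setT <= i setT.
Proof.
move=> cond.
have [m0 fe0] : exists m, feasible m x.
  have [c ic] : exists c, forall X, i X <= c.
    by exists (\max_X i X) => X; exact: leq_bigmax.
  exists (fun=> c + r); apply/feasibleP=> X Y /set0Pn[v vX] _.
  rewrite /vsum (bigD1 v) //=; have := ic X; lia.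
have [n] := ubnP (vsum m0 setT); elim: n m0 fe0 => // n IH m fe ltmn.
have [/existsP[b /andP[mb fe']]|/existsPn stuck] :=
  boolP [exists b, (0 < m b) && feasible (fun v => m v - (v == b)) x].
  by apply: IH fe' _; have := vsum_decr setT mb; rewrite inE; lia.
exists m => //.
have [b|P [y [pP tP]]] := @tight_partition m x pred0 fe.
  have := stuck b; case: posnP => /= [mb0 _|mb /infeasible[X [Y [X0 sYX]]]].
    (* When [m b = 0], feasibility at [[set b]] and [q <= r] force equality. *)
    exists [set b], [set b]; split; rewrite ?set11 //.
    have b0 : [set b] != set0 by rewrite -cards_eq0 cards1.
    have := feasibleP _ _ fe _ _ b0 (subxx _); have := q_le [set b].
    by rewrite /tight b0 subxx setDv vsum0 vsum1 mb0 /=; lia.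
  have := feasibleP _ _ fe _ _ X0 sYX; have := vsum_decr X mb.
  case bX: (b \in X) => /= e h1 h2; last by lia.
  by exists X, Y; split; rewrite // /tight X0 sYX /=; lia.
have sy : {in P, forall X, y X \subset X} by move=> X /tP[/and3P[]].
have := cond P y pP sy; rewrite -(partition_sum m pP).
suff : \sum_(X in P) (i X + r) =
  \sum_(X in P) vsum m X + \sum_(X in P) (q (y X) + vsum x (X :\: y X)) by lia.
by rewrite -big_split; apply: eq_bigr => X /tP[/and3P[_ _ /eqP<-] _] /=; lia.
Qed.

(** [x] is lowered one unit at a time, with [m] adjusted. When this is stuck, a tight partition and
    the hypothesis, which is (iv) plus the edges inside the blocks, give [m(V) + x(V) <= i(V) + k],
    against [m(V) >= i(V)] and [x(V) > k]. *)
Lemma feasible_reduce f k m x :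
    feasible m x -> vsum m setT <= i setT -> (forall v, f v <= x v) -> k <= vsum x setT ->
    (forall (P : {set {set V}}) (y : {set V} -> {set V}),
      partition P [set: V] -> {in P, forall X, y X \subset X} ->
      \sum_(X in P) (i X + r + vsum f (y X)) <= i setT + k + \sum_(X in P) q (y X)) ->
  exists m' x', [/\ feasible m' x', vsum m' setT <= i setT,
    forall v, f v <= x' v <= x v & vsum x' setT = k].
Proof.
move=> fe mN fx kx cond.
have [n] := ubnP (vsum x setT); elim: n m x fe mN fx kx => // n IH m x fe mN fx kx ltxn.
have [->|nk] := eqVneq k (vsum x setT).
  by exists m, x; split=> // v; rewrite fx /=.
(* Otherwise [x = f], and the one-block partition with [Y = V] gives [f(V) <= k]. *)
have [d fd] : exists d, f d < x d.
  apply/existsP; apply: contraLR nk => /existsPn nf; rewrite negbK.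
  have xf : vsum x setT = vsum f setT.
    by apply: eq_bigr => v _; apply/eqP; rewrite eqn_leq fx leqNgt nf.
  rewrite eqn_leq kx xf /=; have [V0|[v vT]] := set_0Vmem [set: V].
    by rewrite V0 vsum0.
  have pT : partition [set setT] [set: V].
    apply/and3P; split; first by rewrite /cover big_set1.
      by apply/trivIsetP=> X Y; rewrite !inE => /eqP-> /eqP->; rewrite eqxx.
    by rewrite inE eq_sym -cards_eq0 (cardD1 v) vT.
  have := cond _ id pT (fun X _ => subxx X); rewrite !big_set1.
  by have := q_le setT; lia.
have step v m' : f v < x v -> feasible m' (fun w => x w - (w == v)) ->
    vsum m' setT <= i setT -> exists m'' x', [/\ feasible m'' x',
    vsum m'' setT <= i setT, forall v, f v <= x' v <= x v & vsum x' setT = k].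
  move=> fv fe' mN'; have x0 : 0 < x v by lia.
  have := vsum_decr setT x0; rewrite inE /= => xE.
  have [w|||m'' [x' [? ? fx' ?]]] := IH _ _ fe' mN'; try by lia.
    by case: eqP => [->|_]; rewrite ?subn0 //; lia.
  by exists m'', x'; split=> // w; have := fx' w; lia.
have [ltmN|geNm] := ltnP (vsum m setT) (i setT).
  (* While [m] is short of [i setT], the unit taken from [x] at [d] is given to [m] at [d], which
     preserves every constraint. *)
  apply: (step d (fun w => m w + (w == d)) fd); last by rewrite vsum_incr inE; lia.
  apply/feasibleP=> X Y X0 sYX; have := feasibleP _ _ fe _ _ X0 sYX.
  have x0 : 0 < x d by lia.
  have := vsum_decr (X :\: Y) x0; rewrite vsum_incr inE.
  by case: (d \in X); case: (d \in Y) => /=; lia.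
(* Otherwise try to lower x at v while moving one unit of m from b to v.  If this
   always fails, a tight pair (X, Y) with b in X and v outside Y blocks it; the
   intersection over all v with f v < x v avoids them all, for every b. *)
pose mv v b w := m w + (w == v) - (w == b).
have mvE v b X : (b == v) || (0 < m b) -> vsum (mv v b) X + (b \in X) = vsum m X + (v \in X).
  by move=> hb; rewrite vsum_decr ?vsum_incr //; move: hb; rewrite /= addn_gt0 lt0b orbC.
have [|/existsPn stuck] := boolP [exists v, exists b,
    [&& f v < x v, (b == v) || (0 < m b) & feasible (mv v b) (fun w => x w - (w == v))]].
  case/existsP=> v /existsP[b /and3P[fv hb fe']]; apply: step fv fe' _.
  by have := mvE v b setT hb; rewrite !inE; lia.
have block b v : f v < x v -> exists X Y, [/\ tight m x X Y, b \in X & v \notin Y].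
  move=> fv; have /existsPn/(_ b) := stuck v; rewrite fv /=.
  have [hb|] := boolP ((b == v) || (0 < m b)) => /=.
    (* The move changes the right-hand side by [[v in Y] - [b in X]], so a pair that becomes
       violated was tight, with [b] in [X] and [v] outside [Y]. *)
    case/infeasible=> X [Y [X0 sYX]]; have := feasibleP _ _ fe _ _ X0 sYX.
    have x0 : 0 < x v by lia.
    have := vsum_decr (X :\: Y) x0; have := mvE v b X hb; rewrite inE /tight.
    have := subsetP sYX v.
    case bX: (b \in X); case vX: (v \in X); case vY: (v \in Y) => //= sv e1 e2 h1 h2; try lia;
      try (by have := sv isT);
      exists X, Y; split; rewrite ?vY ?X0 ?sYX //=; lia.
  rewrite negb_or -leqNgt leqn0 => /andP[nbv /eqP mb0] _.
  have b0 : [set b] != set0 by rewrite -cards_eq0 cards1.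
  exists [set b], [set b]; split; rewrite ?set11 //; last by rewrite inE eq_sym.
  have := feasibleP _ _ fe _ _ b0 (subxx _); have := q_le [set b].
  by rewrite /tight b0 subxx setDv vsum0 vsum1 mb0 /=; lia.
have blocks b (s : seq V) : all (fun v => f v < x v) s ->
    exists X Y, [/\ tight m x X Y, b \in X & all (fun v => v \notin Y) s].
  elim: s => [_|v s IHs /= /andP[fv /IHs[X1 [Y1 [t1 bX1 aY1]]]]].
    by have [X [Y [tXY bX _]]] := block b d fd; exists X, Y.
  have [X2 [Y2 [t2 bX2 vY2]]] := block b v fv.
  have nI : X1 :&: X2 != set0 by apply/set0Pn; exists b; rewrite inE bX1.
  have /andP[_ tI] := tightUI fe t1 t2 nI.
  exists (X1 :&: X2), (Y1 :&: Y2); rewrite inE bX1 bX2 inE (negbTE vY2) andbF; split=> //=.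
  by apply: sub_all aY1 => w; rewrite inE; apply: contraNN => /andP[].
have [b|P [y [pP tP]]] := @tight_partition m x (fun v => f v < x v) fe.
  have [|X [Y [tXY bX aY]]] := blocks b (enum [pred v | f v < x v]).
    by apply/allP=> v; rewrite mem_enum.
  exists X, Y; split=> // v vY; apply/negP=> fv.
  by have /allP/(_ v) := aY; rewrite mem_enum inE fv vY => /(_ isT).
have sy : {in P, forall X, y X \subset X} by move=> X /tP[/and3P[]].
have := cond P y pP sy.
suff : \sum_(X in P) (i X + r + vsum f (y X)) = 
       vsum m setT + vsum x setT + \sum_(X in P) q (y X) by lia.
rewrite -!(partition_sum _ pP) -!big_split; apply: eq_bigr => X /tP[/and3P[_ sX /eqP<-] nD] /=.
(* [y X] avoids the vertices where [x] exceeds [f]. *)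
have -> : vsum f (y X) = vsum x (y X); last by have := vsumD x sX; lia.
by apply: eq_bigr => v /nD; have := fx v; lia.
Qed.

End Vectors.

(** * Choice of the root elements *)

Section Selection.
Variables (V S : finType) (loc : S -> V) (M : matroid S).
Variables (i : {set V} -> nat) (r : nat) (m x : V -> nat).
Hypothesis i_supermod : forall X Y, i X + i Y <= i (X :|: Y) + i (X :&: Y).

Lemma rk_preim_submod (R : {set S}) (X Y : {set V}) :
  rk M (R :&: loc @^-1: (X :|: Y)) + rk M (R :&: loc @^-1: (X :&: Y)) <=
  rk M (R :&: loc @^-1: X) + rk M (R :&: loc @^-1: Y).
Proof.
have := rkUI M (R :&: loc @^-1: X) (R :&: loc @^-1: Y).
by rewrite -setIUr -setIIr -preimsetU -preimsetI.
Qed.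

(** If a minimal [R] had more than [x v] elements at [v], uncrossing the pairs that block their
    removal would give one tight pair [(X, Y)] with [v] in [Y] and all of them coloops of [R_Y].
    Passing to [Y :\ v] would then lower the rank by more than the [x v] gained in
    [vsum x (X :\: Y)], violating feasibility. *)
Lemma select_roots :
    feasible i (fun Y => rk M (loc @^-1: Y)) r m x ->
    (forall v, x v <= rk M (loc @^-1: [set v])) ->
  exists R : {set S},
    [/\ forall v, #|R :&: loc @^-1: [set v]| = x v,
        forall v, indep M (R :&: loc @^-1: [set v])
      & forall X, X != set0 -> i X + r <= vsum m X + rk M (R :&: loc @^-1: X)].
Proof.
move=> fe xle; pose q (R : {set S}) (Y : {set V}) := rk M (R :&: loc @^-1: Y).
pose ok R := feasible i (q R) r m x && [forall v, x v <= q R [set v]].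
have [R /minsetP[/andP[feR /forallP xR] minR] _] : {R | minset ok R & R \subset setT}.
  apply: minset_exists; apply/andP; split; last by apply/forallP=> v; rewrite /q setTI.
  by apply/feasibleP=> X Y X0 sYX; rewrite /q setTI; apply: (feasibleP _ _ _ _ _ fe).
suff cR v : #|R :&: loc @^-1: [set v]| <= x v.
  have xE v : #|R :&: loc @^-1: [set v]| = x v.
    by have := cR v; have := xR v; have := rk_card M (R :&: loc @^-1: [set v]); rewrite /q; lia.
  exists R; split=> // [v|X X0]; first by rewrite /indep eqn_leq rk_card xE; apply: xR.
  have := feasibleP _ _ _ _ _ feR _ _ X0 (subxx X); rewrite setDv vsum0 /q; lia.
rewrite leqNgt; apply/negP=> gtRv; set Rv := R :&: _ in gtRv.
have drop s (Y : {set V}) : s \in Rv -> q (R :\ s) Y < q R Y ->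
    v \in Y /\ rk M ((R :&: loc @^-1: Y) :\ s) < rk M (R :&: loc @^-1: Y).
  rewrite /q setIDAC !inE => /andP[_ /eqP sv] lt; split=> //.
  apply: contraLR lt => nvY; rewrite -leqNgt (setDidPl _) //.
  by rewrite disjoint_sym disjoints1 !inE sv (negbTE nvY) andbF.
have block s : s \in Rv ->
    (exists2 Y : {set V}, v \in Y & rk M ((R :&: loc @^-1: Y) :\ s) < rk M (R :&: loc @^-1: Y)) /\
    (q (R :\ s) [set v] < x v \/ exists X Y : {set V}, [/\ tight i (q R) r m x X Y, v \in Y &
      rk M ((R :&: loc @^-1: Y) :\ s) < rk M (R :&: loc @^-1: Y)]).
  move=> sRv; have Rs : s \in R by case/setIP: sRv.
  have : ~~ ok (R :\ s).
    by apply/negP=> /minR/(_ (subsetDl _ _)) e; move: Rs; rewrite -e !inE eqxx.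
  rewrite negb_and => /orP[/infeasible[X [Y [X0 sYX lt]]]|/forallPn[w]].
    have le := feasibleP _ _ _ _ _ feR _ _ X0 sYX.
    have [|vY ltY] := drop s Y sRv; first by lia.
    have leY : rk M (R :&: loc @^-1: Y) <= (q (R :\ s) Y).+1.
      apply: leq_trans (rk_U1 M s _); apply: rkS; apply/subsetP=> t; rewrite !inE.
      by case: eqP.
    split; first by exists Y.
    right; exists X, Y; split=> //; rewrite /tight X0 sYX /=; move: lt le leY; rewrite /q; lia.
  rewrite -ltnNge => ltw; have [|vw lt] := drop s [set w] sRv; first by have := xR w; lia.
  by move: vw ltw lt; rewrite inE => /eqP<- ltw lt; split; [exists [set v]; rewrite ?set11|left].
have sRvY (Y : {set V}) : v \in Y -> Rv \subset R :&: loc @^-1: Y.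
  by move=> vY; apply: setIS; apply: preimsetS; rewrite sub1set.
(* Every s in Rv is a coloop of R at some set containing v, hence of Rv. *)
have iRv : indep M Rv.
  have := @rkD_coloops _ M Rv Rv (subxx _); rewrite setDv rk0 /indep => h.
  rewrite eqn_leq rk_card; apply: h => s sRv.
  have [[Y vY ltY] _] := block s sRv.
  apply: (@coloopsS _ M [set s] (R :&: loc @^-1: Y)); rewrite ?sub1set ?sRvY ?set11 //.
  by move=> t; rewrite inE => /eqP->.
have tightv s : s \in Rv -> exists X Y : {set V}, [/\ tight i (q R) r m x X Y, v \in Y &
      rk M ((R :&: loc @^-1: Y) :\ s) < rk M (R :&: loc @^-1: Y)].
  move=> sRv; have [_ []//] := block s sRv.
  (* [Rv] is independent with more than [x v] elements, so without [s] its rank is still at least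
     [x v]: only a tight pair can block. *)
  have := indepS (subsetDl Rv [set s]) iRv; rewrite /indep /q setIDAC -/Rv => /eqP->.
  by have := cardsD1 s Rv; rewrite sRv; lia.
have tights (l : seq S) : all (mem Rv) l ->
    exists X Y : {set V}, [/\ tight i (q R) r m x X Y, v \in Y &
      {in l, forall s, rk M ((R :&: loc @^-1: Y) :\ s) < rk M (R :&: loc @^-1: Y)}].
  elim: l => [_|s l IH /= /andP[sRv lRv]].
    have [s sRv] : exists s, s \in Rv by apply/set0Pn; rewrite -card_gt0; lia.
    by have [X [Y [t vY _]]] := tightv s sRv; exists X, Y.
  have [X1 [Y1 [t1 vY1 l1]]] := IH lRv.
  have [X2 [Y2 [t2 vY2 l2]]] := tightv s sRv.
  have nI : X1 :&: X2 != set0.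
    case/and3P: t1 => _ s1 _; case/and3P: t2 => _ s2 _.
    by apply/set0Pn; exists v; rewrite inE (subsetP s1) ?(subsetP s2).
  have /andP[_ tI] := tightUI i_supermod (rk_preim_submod R) feR t1 t2 nI.
  exists (X1 :&: X2), (Y1 :&: Y2); rewrite inE vY1 vY2; split=> // t.
  have vI : v \in Y1 :&: Y2 by rewrite inE vY1.
  have shrink (Y : {set V}) : Y1 :&: Y2 \subset Y -> t \in Rv -> 
     rk M ((R :&: loc @^-1: Y) :\ t) < rk M (R :&: loc @^-1: Y) ->
     rk M ((R :&: loc @^-1: (Y1 :&: Y2)) :\ t) < rk M (R :&: loc @^-1: (Y1 :&: Y2)).
    move=> sY tR lt; apply: (@coloopsS _ M [set t] (R :&: loc @^-1: Y)); rewrite ?set11 //.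
    - by rewrite sub1set (subsetP (sRvY _ vI)).
    - by rewrite setIS ?preimsetS.
    - by move=> t'; rewrite inE => /eqP->.
  rewrite inE => /orP[/eqP tE|tl].
    by apply: (shrink Y2); rewrite ?subsetIr // tE.
  apply: (shrink Y1); rewrite ?subsetIl //; [exact: (allP lRv)|exact: l1].
have [|X [Y [tXY vY cl]]] := tights (enum Rv).
  by apply/allP=> s; rewrite mem_enum.
have clRv : coloops M Rv (R :&: loc @^-1: Y) by move=> s sRv; apply: cl; rewrite mem_enum.
have := rkD_coloops (sRvY _ vY) clRv.
have -> : (R :&: loc @^-1: Y) :\: Rv = R :&: loc @^-1: (Y :\ v).
  by apply/setP=> s; rewrite !inE; case: (s \in R) => //=; case: eqP.
case/and3P: tXY => X0 sYX /eqP tXY.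
have := feasibleP _ _ _ _ _ feR X (Y :\ v) X0 (subset_trans (subsetDl _ _) sYX).
have := vsumD x (subset_trans (subsetDl Y [set v]) sYX); have := vsumD x sYX.
have := @vsumD _ x Y [set v]; rewrite sub1set vY vsum1 => /(_ isT).
move: tXY gtRv; rewrite /q; lia.
Qed.

End Selection.

(** * Edges inside a set and orientations with given in-degrees *)

Section Edges.
Variables (V E : finType) (G : graph V E).
Implicit Types (X Y : {set V}) (F : {set E}) (m : V -> nat).

Definition inner F X :=
  #|[set e in F | ((ends G e).1 \in X) && ((ends G e).2 \in X)]|.

Lemma inner_supermod F X Y :
  inner F X + inner F Y <= inner F (X :|: Y) + inner F (X :&: Y).
Proof.
apply: leq_cardD => e; rewrite !inE; case: (e \in F) => //=.
by do 4!case: (_ \in _).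
Qed.

Lemma innerT : inner setT setT = #|E|.
Proof. by rewrite -cardsT; apply: eq_card => e; rewrite !inE. Qed.

Lemma innerD1 F e X : e \in F ->
  inner F X = inner (F :\ e) X + (((ends G e).1 \in X) && ((ends G e).2 \in X)).
Proof.
move=> eF; rewrite /inner (cardsD1 e) !inE eF /= addnC; congr (_ + _).
by apply: eq_card => z; rewrite !inE andbA.
Qed.

Lemma inner_cross (P : {set {set V}}) : partition P [set: V] ->
  \sum_(X in P) inner setT X + cross_edges G P = #|E|.
Proof.
case/and3P=> /eqP covP tiP _.
rewrite -(cardsC [set e | pblock P (ends G e).1 == pblock P (ends G e).2]).
congr (_ + _); last by apply: eq_card => e; rewrite !inE.
transitivity (\sum_(X in P) \sum_e ((ends G e).1 \in X) && ((ends G e).2 \in X)).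
  apply: eq_bigr => X _; rewrite -big_mkcond /= sum1_card.
  by apply: eq_card => e; rewrite !inE.
rewrite exchange_big -sum1_card [RHS]big_mkcond /=; apply: eq_bigr => e _.
set a := (ends G e).1; set b := (ends G e).2.
have cov v : v \in cover P by rewrite covP.
rewrite (bigD1 (pblock P a)) ?pblock_mem //= mem_pblock cov /= big1 => [|X /andP[XP nX]].
  by rewrite addn0 inE eq_pblock // eq_sym; case: (_ == _).
apply/eqP; rewrite eqb0 negb_and; apply/orP; left.
by apply: contra nX => aX; rewrite (def_pblock tiP XP aX).
Qed.

(** Hakimi's theorem: [e] can be directed to its end [h] unless the other edges inside some set
    containing [h] already use up [m] there. If both ends had such a set, union and intersection
    could not both satisfy the hypothesis, as [e] lies inside the union. *)
Lemma orientation F m :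
    (forall X, inner F X <= vsum m X) -> vsum m setT <= #|F| ->
  exists2 o : E -> V * V, (forall e, joins G e (o e).1 (o e).2) &
    forall X, vsum m X <= #|[set e in F | (o e).2 \in X]|.
Proof.
have [n] := ubnP #|F|; elim: n F m => // n IH F m ltFn lowm upm.
have [F0|[e eF]] := set_0Vmem F.
  exists (ends G) => [e|X]; first by rewrite /joins -surjective_pairing eqxx.
  by have := vsumS m (subsetT X); move: upm; rewrite F0 cards0; lia.
have cF : #|F| = #|F :\ e|.+1 by rewrite (cardsD1 e) eF.
pose ok h := [forall X : {set V}, (h \in X) ==> (inner (F :\ e) X < vsum m X)].
have [h hP okh] : exists2 h : V, exists t : V, joins G e t h & ok h.
  have [ok2|/forallPn[X]] := boolP (ok (ends G e).2).
    exists (ends G e).2 => //; exists (ends G e).1.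
    by rewrite /joins -surjective_pairing eqxx.
  have [ok1 _|/forallPn[Y]] := boolP (ok (ends G e).1).
    exists (ends G e).1 => //; exists (ends G e).2.
    by rewrite /joins -surjective_pairing eqxx orbT.
  rewrite !negb_imply -!leqNgt => /andP[eY leY] /andP[eX leX].
  have := lowm (X :|: Y); have := lowm (X :&: Y); rewrite !(innerD1 _ eF).
  have := inner_supermod (F :\ e) X Y; have := vsumUI m X Y.
  by rewrite !inE eX eY orbT /=; lia.
case: hP => t th.
have mh : 0 < m h.
  by have /forallP/(_ [set h]) := okh; rewrite set11 vsum1 /=; lia.
have [|X||o oG oF] := IH (F :\ e) (fun v => m v - (v == h)).
- by move: ltFn; rewrite cF.
- have := vsum_decr X mh; have /forallP/(_ X) := okh; have := lowm X.
  by rewrite (innerD1 _ eF); case: (h \in X) => /=; lia.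
- by have := vsum_decr setT mh; rewrite inE; move: upm; rewrite cF; lia.
exists (fun z => if z == e then (t, h) else o z) => [z|X].
  by case: eqP => [->|_].
rewrite -(vsum_decr X mh) (cardsD1 e) !inE eF eqxx /= addnC leq_add2l.
apply: leq_trans (oF X) _; apply: eq_leq; apply: eq_card => z; rewrite !inE.
by case: eqP.
Qed.

End Edges.

(** * The covering condition and one step of growth *)

Section Growth.
Variables (V E S : finType) (M : matroid S) (o : E -> V * V).
Implicit Types (X Y : {set V}) (F : {set E}) (B : V -> {set S}).

Definition entering F X := #|[set e in F | ((o e).2 \in X) && ((o e).1 \notin X)]|.

Definition covering F B := forall X, X != set0 ->
  rk M setT <= entering F X + rk M (\bigcup_(v in X) B v).

Lemma entering_submod F X Y :
  entering F (X :&: Y) + entering F (X :|: Y) <= entering F X + entering F Y.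
Proof.
apply: leq_cardD => e; rewrite !inE; case: (e \in F) => //=.
by do 4!case: (_ \in _).
Qed.

Lemma enteringD1 F e X : e \in F ->
  entering F X = entering (F :\ e) X + (((o e).2 \in X) && ((o e).1 \notin X)).
Proof.
move=> eF; rewrite /entering (cardsD1 e) !inE eF /= addnC; congr (_ + _).
by apply: eq_card => z; rewrite !inE andbA.
Qed.

(* If Y is the set of vertices of X that reach v inside X, then B_Y spans B_X as
   all arcs entering Y enter X; hence closure B_v is left along a path to v. *)
Lemma tight_arc F B X v : covering F B ->
    entering F X + rk M (\bigcup_(w in X) B w) = rk M setT -> v \in X ->
    ~~ (\bigcup_(w in X) B w \subset mclosure M (B v)) ->
  exists e s, [/\ e \in F, (o e).1 \in X, (o e).2 \in X, s \in B (o e).1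
    & s \notin mclosure M (B (o e).2)].
Proof.
move=> cov tX vX nsub.
pose arc a b := [exists e in F, [&& o e == (a, b), a \in X & b \in X]].
pose Y := [set w in X | connect arc w v].
have vY : v \in Y by rewrite inE vX connect0.
have sYX : Y \subset X by apply/subsetP=> w; rewrite inE => /andP[].
have sBYX : \bigcup_(w in Y) B w \subset \bigcup_(w in X) B w.
  by apply/bigcupsP=> w wY; apply: bigcup_sup; apply: (subsetP sYX).
have eYX : entering F Y <= entering F X.
  apply: subset_leq_card; apply/subsetP=> e; rewrite !inE.
  case/and3P=> eF /andP[hX hv]; rewrite eF hX /=; apply: contra => tX'.
  rewrite tX' /=; apply: connect_trans hv; apply: connect1; apply/exists_inP.
  by exists e; rewrite // -surjective_pairing eqxx tX'.
have sBXY : \bigcup_(w in X) B w \subset mclosure M (\bigcup_(w in Y) B w).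
  have rXY : rk M (\bigcup_(w in X) B w) <= rk M (\bigcup_(w in Y) B w).
    by have := cov Y; case: eqP vY => [->|_ _ /(_ isT)]; rewrite ?inE //; lia.
  apply/subsetP=> s sX; rewrite inE; apply: leq_trans rXY; apply: rkS.
  by rewrite subUset sub1set sX.
have [w wY nw] : exists2 w, w \in Y & ~~ (B w \subset mclosure M (B v)).
  apply/exists_inP; apply: contraR nsub => /exists_inPn nY.
  apply: subset_trans sBXY _; apply: mclosure_sub; apply/bigcupsP=> w /nY.
  by rewrite negbK.
have [a [b [/exists_inP[e eF /and3P[/eqP oe aX bX]] na]]] :
    exists a b, [/\ arc a b, ~~ (B a \subset mclosure M (B v)) & B b \subset mclosure M (B v)].
  move: wY; rewrite inE => /andP[_ cwv].
  pose far w := ~~ (B w \subset mclosure M (B v)).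
  have [|a [b [ab na]]] := connect_exit (P := far) cwv nw.
    by rewrite negbK sub_mclosure.
  by rewrite negbK; exists a, b.
move=> sb; have [s sa ns] := subsetPn na.
exists e, s; rewrite oe; split=> //.
by apply: contra ns; apply: subsetP; apply: mclosure_sub.
Qed.

(** Sending [s] along [e] can break the condition only at a tight set entered by [e] whose elements
    already span [s]; this is [bad]. *)
Lemma growth_step F B : covering F B ->
  (forall v, rk M setT <= rk M (B v)) \/
  exists e s, [/\ e \in F, s \in B (o e).1, s \notin mclosure M (B (o e).2)
    & covering (F :\ e) (fun v => if v == (o e).2 then s |: B v else B v)].
Proof.
move=> cov; pose BX X := \bigcup_(w in X) B w.
pose arc e s := [&& e \in F, s \in B (o e).1 & s \notin mclosure M (B (o e).2)].
pose bad e s X := [&& (o e).2 \in X, (o e).1 \notin X, s \in mclosure M (BX X)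
  & entering F X + rk M (BX X) == rk M setT].
have [/existsP[e /existsP[s /andP[/and3P[eF se ns] /existsPn nbad]]]|stuck] :=
  boolP [exists e, exists s, arc e s && ~~ [exists X, bad e s X]].
  right; exists e, s; split=> // X X0; have := cov X X0.
  rewrite (enteringD1 _ eF); set BX' := \bigcup_(_ in _) (if _ then _ else _).
  have sB : BX X \subset BX'.
    apply/bigcupsP=> v vX; apply: subset_trans (bigcup_sup v vX).
    by case: ifP => // _; apply: subsetUr.
  have := rkS M sB; rewrite -/(BX X).
  case hX: ((o e).2 \in X); case tX: ((o e).1 \in X) => /=; try lia.
  have := nbad X; rewrite /bad hX tX inE (enteringD1 _ eF) hX tX /=.
  have : rk M (s |: BX X) <= rk M BX'.
    apply: rkS; rewrite subUset sB andbT sub1set; apply/bigcupP; exists (o e).2 => //.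
    by rewrite eqxx setU11.
  have := rk_U1 M s (BX X); lia.
left.
have has_bad e s : arc e s -> exists X, bad e s X.
  move=> es; have /existsPn/(_ e)/existsPn/(_ s) := stuck.
  by rewrite es /= negbK => /existsP.
(* In a smallest bad X there is an arc e' to which tight_arc applies; a bad set of
   e' then intersects X in a smaller bad set. *)
have no_bad n : forall e s X, #|X| < n -> arc e s -> ~~ bad e s X.
  elim: n => // n IH e s X ltXn /and3P[eF se ns]; apply/negP=> /and4P[hX tX sX /eqP tiX].
  have [|e' [s' [e'F t'X h'X s'e' ns']]] := tight_arc cov tiX hX.
    by apply: contra ns => sub; apply: (subsetP (mclosure_sub sub)).
  have arc' : arc e' s' by rewrite /arc e'F s'e'.
  have [X' /and4P[h'X' t'X' s'X' /eqP tiX']] := has_bad e' s' arc'.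
  have ltI : #|X :&: X'| < n.
    rewrite -ltnS; apply: leq_trans ltXn; rewrite ltnS; apply: proper_card.
    by apply/properP; split; [apply: subsetIl | exists (o e').1; rewrite // inE t'X].
  have /negP[] := IH e' s' (X :&: X') ltI arc'.
  rewrite /bad !inE h'X h'X' t'X (negbTE t'X') /=.
  have nI : X :&: X' != set0 by apply/set0Pn; exists (o e').2; rewrite inE h'X.
  have nU : X :|: X' != set0 by apply/set0Pn; exists (o e').2; rewrite inE h'X.
  have := cov _ nI; have := cov _ nU; rewrite -!/(BX _).
  have := entering_submod F X X'.
  (* Adjoining [s'] raises neither rank, so submodularity makes [X :&: X'] tight and puts [s'] in
     its span. *)
  have := rkUI M (s' |: BX X) (s' |: BX X').
  have clX : rk M (s' |: BX X) <= rk M (BX X).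
    have := subsetP (sub_mclosure M (BX X)) s'; rewrite inE; apply.
    by apply/bigcupP; exists (o e').1.
  have := s'X'; rewrite inE => clX'.
  have : rk M (BX (X :|: X')) <= rk M ((s' |: BX X) :|: (s' |: BX X')).
    by apply: rkS; rewrite /BX bigcup_setU; apply: setUSS; apply: subsetUr.
  have : rk M (s' |: BX (X :&: X')) <= rk M ((s' |: BX X) :&: (s' |: BX X')).
    apply: rkS; rewrite -setUIr; apply: setUS; rewrite subsetI.
    by apply/andP; split; apply/bigcupsP=> v; rewrite inE => /andP[vX vX']; apply: bigcup_sup.
  have := rkS M (subsetUr [set s'] (BX (X :&: X'))); rewrite -/(BX _).
  move: tiX tiX' clX clX'; clearbody BX; clear. lia.
have stuck' e s : arc e s -> False.
  by move=> es; have [X] := has_bad e s es; apply/negP; apply: (no_bad #|X|.+1).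
move=> v; have nT : [set: V] != set0 by apply/set0Pn; exists v; rewrite inE.
(* No arc enters [V], so [V] is tight; if [B v] did not span, [tight_arc] would yield a candidate
   arc. *)
have eT : entering F setT = 0 by apply: eq_card0 => e; rewrite !inE andbF.
have tT : entering F setT + rk M (\bigcup_(w in setT) B w) = rk M setT.
  by have := cov _ nT; have := rkS M (subsetT (\bigcup_(w in setT) B w)); lia.
have sub : \bigcup_(w in setT) B w \subset mclosure M (B v).
  apply: contraT => /(tight_arc cov tT (in_setT v))[e [s [eF _ _ se ns]]].
  by case: (@stuck' e s); rewrite /arc eF se.
by rewrite -{1}tT eT -(rk_mclosure M (B v)); apply: rkS.
Qed.

End Growth.

(** * Attaching leaves to trees, and crossing edges of connected subgraphs *)

Section Trees.
Variables (V E : finType) (G : graph V E).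
Implicit Types (U X : {set V}) (F A : {set E}).

Lemma joins_ends e x y : joins G e x y -> ends G e = (x, y) \/ ends G e = (y, x).
Proof. by case/orP=> /eqP; [left | right]. Qed.

Lemma subset_adj A F x y : A \subset F -> connect (adj G A) x y -> connect (adj G F) x y.
Proof.
move=> sAF; apply: connect_sub => a b /exists_inP[e eA ab]; apply: connect1.
by apply/exists_inP; exists e; rewrite ?(subsetP sAF).
Qed.

Lemma is_tree1 v : is_tree G [set v] set0.
Proof.
split=> [e||x]; rewrite ?inE //.
  split=> [|x y /set1P-> /set1P-> //]; by apply/set0Pn; exists v; rewrite inE.
by case=> // [[e y] w]; rewrite /is_cycle /= inE.
Qed.

(** Exactly the edges with one end at [v] toggle whether the walk is at [v]. *)
Lemma odd_walk F v x w : walk G F x w ->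
  odd (count (fun e => ((ends G e).1 == v) (+) ((ends G e).2 == v)) (unzip1 w)) =
  (x == v) (+) (last x (unzip2 w) == v).
Proof.
elim: w x => [x _|[e y] w IH x /= /and3P[_ /joins_ends xy /IH]]; first by rewrite addbb.
rewrite oddD oddb => ->.
by case: xy => -> /=; case: (x == v); case: (y == v); case: (_ == v).
Qed.

Lemma walkD1 F e x w : walk G (e |: F) x w -> e \notin unzip1 w -> walk G F x w.
Proof.
elim: w x => // [[a y] w] IH x /= /and3P[aF -> wF].
rewrite inE negb_or => /andP[nea nw]; rewrite IH //.
by move: aF; rewrite !inE eq_sym (negbTE nea) /= => ->.
Qed.

Lemma walk_edges F x w : walk G F x w -> {subset unzip1 w <= F}.
Proof.
elim: w x => // [[a y] w] IH x /= /and3P[aF _ /IH wF] e.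
by rewrite inE => /orP[/eqP->|/wF].
Qed.

Lemma is_tree_leaf U A e u v : is_tree G U A -> joins G e u v -> u \in U -> v \notin U ->
  is_tree G (v |: U) (e |: A).
Proof.
move=> [sub [_ con] acy] euv uU nvU.
have sA : A \subset e |: A by apply: subsetUr.
have sub' : is_subgraph G (v |: U) (e |: A).
  move=> a; rewrite !inE => /orP[/eqP->|/sub/andP[-> ->]]; last by rewrite !orbT.
  by case: (joins_ends euv) => -> /=; rewrite eqxx uU ?orbT.
split=> //.
  split; first by apply/set0Pn; exists v; rewrite setU11.
  have adjS : connect_sym (adj G (e |: A)).
    apply: sym_connect_sym => a b; apply: eq_existsb => z; rewrite /joins.
    by congr (_ && _); rewrite orbC.
  have cu x : x \in v |: U -> connect (adj G (e |: A)) u x.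
    rewrite inE => /orP[/set1P->|xU]; last by apply: subset_adj sA (con _ _ uU xU).
    by apply: connect1; apply/exists_inP; exists e; rewrite ?setU11.
  by move=> x y xU yU; apply: connect_trans (cu y yU); rewrite adjS cu.
move=> x w; apply/negP=> /and5P[w0 wk /eqP wx ue uv].
(* e is the only edge leaving v, and a closed walk crosses a cut evenly often. *)
have ne : e \notin unzip1 w.
  have := odd_walk v wk; rewrite wx addbb.
  have -> : count (fun a => ((ends G a).1 == v) (+) ((ends G a).2 == v)) (unzip1 w) =
      count_mem e (unzip1 w).
    apply: eq_in_count => a /(walk_edges wk) /=; rewrite inE => /orP[/set1P->|aA].
      rewrite eqxx; have uv' : u == v = false by apply: contraNF nvU => /eqP<-.
      by case: (joins_ends euv) => -> /=; rewrite eqxx uv'.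
    have nv z : z \in U -> z == v = false by move=> zU; apply: contraNF nvU => /eqP<-.
    have /andP[aU1 aU2] := sub a aA; rewrite !nv //=; apply/esym/negbTE.
    apply: contraNN nvU => /eqP ae; move: aU1 aU2; rewrite ae.
    by case: (joins_ends euv) => ->.
  by rewrite count_uniq_mem //; case: (e \in _).
by have /negP[] := acy x w; rewrite /is_cycle w0 (walkD1 wk ne) wx eqxx ue.
Qed.

(** From the block of [v], blocks are reached one by one, each through a crossing edge that leaves
    those already reached and so is new. The block of [v] is not counted, hence no [- 1]. *)
Lemma connected_cross (P : {set {set V}}) U F (v : V) : partition P [set: V] ->
    is_subgraph G U F -> connected G U F -> v \in U ->
  #|[set X in P | (X :&: U != set0) && (v \notin X)]| <=
  #|[set e in F | pblock P (ends G e).1 != pblock P (ends G e).2]|.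
Proof.
move=> /and3P[/eqP covP tiP _] sub [_ con] vU.
have cov x : x \in cover P by rewrite covP.
set Q := [set X in P | _]; set C := [set e in F | _].
suff grow n : n <= #|Q| -> exists W : {set {set V}}, [/\ W \subset Q, #|W| = n &
    n <= #|[set e in C | (pblock P (ends G e).1 \in pblock P v |: W) &&
                         (pblock P (ends G e).2 \in pblock P v |: W)]|].
  have [W [_ _ le]] := grow _ (leqnn _); apply: leq_trans le _.
  by apply: subset_leq_card; apply/subsetP=> e; rewrite inE => /andP[].
elim: n => [_|n IH ltn]; first by exists set0; rewrite sub0set cards0.
have [W [sWQ cW le]] := IH (ltnW ltn).
have [X XQ nXW] : exists2 X, X \in Q & X \notin W.
  by apply/subsetPn; apply: contraL ltn => /subset_leq_card; rewrite cW -leqNgt.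
move: (XQ); rewrite inE => /and3P[XP /set0Pn[x /setIP[xX xU]] nvX].
(* [X] is only a target: the block added to [W] is that of [b]. *)
have [||a [b [/exists_inP[e eF eab] Wa nWb]]] :=
    connect_exit (P := fun z => pblock P z \in pblock P v |: W) (con _ _ vU xU).
- by rewrite setU11.
- rewrite (def_pblock tiP XP xX) !inE negb_or nXW andbT.
  by apply: contra nvX => /eqP->; rewrite mem_pblock.
have bU : b \in U by have /andP[] := sub e eF; case: (joins_ends eab) => ->.
have nvb : v \notin pblock P b.
  by rewrite -eq_pblock // eq_sym; apply: contra nWb => /eqP->; rewrite setU11.
have nbW : pblock P b \notin W by apply: contra nWb => bW; rewrite inE bW orbT.
exists (pblock P b |: W); rewrite cardsU1 nbW cW; split=> //.
  rewrite subUset sWQ andbT sub1set inE pblock_mem // nvb andbT /=.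
  by apply/set0Pn; exists b; rewrite inE mem_pblock cov.
set C' := [set e in C | _] in le *; set C'' := [set e in C | _].
apply: leq_ltn_trans le (proper_card _); apply/properP; split.
  apply/subsetP=> z; rewrite !inE => /andP[-> /andP[h1 h2]] /=.
  by case/orP: h1 => ->; case/orP: h2 => ->; rewrite ?orbT.
move: Wa nWb; rewrite !inE negb_or => Wa /andP[nbv _].
exists e; rewrite !inE eF.
  have ab : pblock P a != pblock P b.
    by apply: contraTneq Wa => ->; rewrite negb_or nbv.
  by case: (joins_ends eab) => -> /=; rewrite ?[pblock P b == pblock P a]eq_sym ab eqxx ?orbT /=;
     case/orP: Wa => ->; rewrite ?orbT.
by case: (joins_ends eab) => -> /=; rewrite (negbTE nbv) (negbTE nbW) ?andbF.
Qed.

(** * Growing a whole packing *)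

Section Growing.
Variables (S : finType) (M : matroid S) (o : E -> V * V) (k : nat).
Variables (s : 'I_k -> S) (root : 'I_k -> V).
Hypothesis o_joins : forall e, joins G e (o e).1 (o e).2.

Let B (U : 'I_k -> {set V}) v := [set s i | i in 'I_k & v \in U i].

(** Each growth step extends the tree of some element [s i]. As this element is not spanned at the
    head, the head is a new leaf and independence persists; once growth stops, the independent sets
    have full rank. *)
Lemma grow_trees F (U : 'I_k -> {set V}) (A : 'I_k -> {set E}) :
    (forall i, is_tree G (U i) (A i)) -> (forall i, root i \in U i) ->
    (forall i j, i != j -> [disjoint A i & A j]) -> (forall i, [disjoint F & A i]) ->
    (forall v, indep M (B U v)) -> covering M o F (B U) ->
  exists (U' : 'I_k -> {set V}) (A' : 'I_k -> {set E}),
  [/\ forall i, is_tree G (U' i) (A' i), forall i, root i \in U' i,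
    forall i j, i != j -> [disjoint A' i & A' j] & forall v, is_basis M (B U' v)].
Proof.
have [n] := ubnP #|F|; elim: n F U A => // n IH F U A ltFn tU rU dA dFA iB cov.
have [full|[e [t [eF /imsetP[i]]]]] := growth_step cov.
  by exists U, A; split=> // v; apply: indep_full_basis.
rewrite inE => /= uU -> ns cov'; set v := (o e).2 in ns cov'.
have nvU : v \notin U i.
  by apply: contra ns => vU; apply: (subsetP (sub_mclosure _ _)); apply: imset_f; rewrite inE.
pose U' j := if j == i then v |: U i else U j.
pose A' j := if j == i then e |: A i else A j.
have BE w : B U' w = if w == v then s i |: B U w else B U w.
  apply/setP=> t'; apply/idP/idP => [/imsetP[j]|].
    rewrite inE /= /U' => jw ->; move: jw; case: (j =P i) => [->|_ jw].
      rewrite inE => /orP[/set1P->|wi]; first by rewrite eqxx setU11.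
      have : s i \in B U w by apply: imset_f; rewrite inE.
      by case: ifP => _ // ?; apply: setU1r.
    have : s j \in B U w by apply: imset_f; rewrite inE.
    by case: ifP => _ // ?; apply: setU1r.
  have old : t' \in B U w -> t' \in B U' w.
    case/imsetP=> j; rewrite inE /= => wj ->; apply: imset_f; rewrite inE /= /U'.
    by case: eqP => // <-; rewrite inE wj orbT.
  case: eqP => [wv|_]; last exact: old.
  rewrite inE => /orP[/set1P->|]; last exact: old.
  by apply: imset_f; rewrite inE /= /U' eqxx wv setU11.
have eA j : e \notin A j by rewrite (disjointFr (dFA j) eF).
apply: (IH (F :\ e) U' A').
- by move: ltFn; rewrite (cardsD1 e) eF.
- by move=> j; rewrite /U' /A'; case: eqP => // _; apply: is_tree_leaf (o_joins e) uU nvU.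
- by move=> j; rewrite /U'; case: eqP => // ->; rewrite inE rU orbT.
- move=> j l nij; rewrite -setI_eq0 /A'.
  have AA a b : a != b -> (e |: A a) :&: A b == set0.
    move=> nab; rewrite setIUl setU_eq0 !setI_eq0 dA // andbT disjoints1.
    by rewrite eA.
  case: (j =P i) nij => [->|_]; case: (l =P i) => [->|_] nij.
  + by rewrite eqxx in nij.
  + exact: AA.
  + by rewrite setIC AA // eq_sym.
  + by rewrite setI_eq0 dA.
- move=> j; have : [disjoint F :\ e & A j] by apply: disjointWl (dFA j); apply: subsetDl.
  rewrite /A'; case: eqP => // -> d.
  rewrite -setI_eq0 setIUr setU_eq0 !setI_eq0 d andbT disjoint_sym disjoints1.
  by rewrite !inE eqxx.
- move=> w; rewrite BE; case: eqP => // ->; exact: indep_U1.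
move=> X X0; have := cov' X X0; congr (_ <= _ + rk M _).
by apply: eq_bigr => w _; rewrite BE.
Qed.

End Growing.
End Trees.

(** * From integer maxima to inequalities between natural numbers *)

Section MaxSubset.
Variable V : finType.
Implicit Types (X Y : {set V}) (P : {set {set V}}).

Lemma le_max_subset X Y (F : {set V} -> int) : Y \subset X -> (F Y <= max_subset X F)%R.
Proof. exact: (@le_bigmax_cond _ _ _ (F set0) Y (fun Y => Y \subset X)). Qed.

Lemma max_subset_le X (F : {set V} -> int) (c : int) :
  (forall Y, Y \subset X -> (F Y <= c)%R) -> (max_subset X F <= c)%R.
Proof. by move=> le; apply: bigmax_le => //; rewrite le ?sub0set. Qed.

Lemma Posz_sum P (h : {set V} -> nat) :
  (\sum_(X in P) (h X)%:Z = (\sum_(X in P) h X)%N%:Z)%R.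
Proof. by rewrite (big_morph Posz PoszD (erefl _)). Qed.

Lemma sum_max_le P (F : {set V} -> {set V} -> int) (c : {set V} -> nat) :
    (forall X Y, X \in P -> Y \subset X -> (F X Y <= (c X)%:Z)%R) ->
  (\sum_(X in P) max_subset X (F X) <= (\sum_(X in P) c X)%N%:Z)%R.
Proof.
move=> le; rewrite -Posz_sum; apply: ler_sum => X XP.
by apply: max_subset_le => Y; apply: le.
Qed.

(** [a] and [b] are the positive and negative terms of the value at the chosen subset, so that no
    subtraction in [nat] occurs. *)
Lemma sum_le_max P (F : {set V} -> {set V} -> int) (y : {set V} -> {set V})
    (a b : {set V} -> nat) (c : nat) :
    (\sum_(X in P) max_subset X (F X) <= c%:Z)%R -> {in P, forall X, y X \subset X} ->
    {in P, forall X, ((a X)%:Z - (b X)%:Z = F X (y X))%R} ->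
  \sum_(X in P) a X <= c + \sum_(X in P) b X.
Proof.
move=> le sy ab.
suff : ((\sum_(X in P) a X)%N%:Z - (\sum_(X in P) b X)%N%:Z <= c%:Z)%R by lia.
apply: le_trans le; rewrite -!Posz_sum -sumrB.
by apply: ler_sum => X XP; rewrite ab // le_max_subset ?sy.
Qed.

End MaxSubset.

(** * Counting roots and crossing edges for necessity *)

Lemma card_fiber (I T : finType) (h : I -> T) (A : {set I}) (Z : {set T}) :
  #|A :&: h @^-1: Z| = vsum (fun v => #|A :&: h @^-1: [set v]|) Z.
Proof.
rewrite -sum1_card (partition_big h (mem Z)) /= => [|i]; last by rewrite !inE => /andP[].
apply: eq_bigr => v vZ; rewrite sum1_card; apply: eq_card => i.
by rewrite unfold_in !inE; case: (h i =P v) => [->|_]; rewrite ?vZ ?andbT ?andbF.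
Qed.

Section Necessity.
Variables (V E S : finType) (G : graph V E) (loc : S -> V) (M : matroid S) (k : nat).
Variables (T : 'I_k -> rooted_tree G) (s : 'I_k -> S).
Hypothesis T_packing : is_packing T.
Hypothesis s_inj : injective s.
Hypothesis s_loc : forall i, loc (s i) = tree_root (T i).
Hypothesis s_basis : forall v, is_basis M [set s i | i in 'I_k & v \in tree_verts (T i)].
Implicit Types (X Y Z : {set V}) (P : {set {set V}}).

Definition rooted_in Z := #|[set i | tree_root (T i) \in Z]|.
Definition trees_into X :=
  #|[set i | (X :&: tree_verts (T i) != set0) && (tree_root (T i) \notin X)]|.

Lemma root_in_tree i : tree_root (T i) \in tree_verts (T i).
Proof. by case: (T i). Qed.

Lemma rooted_inE Z : rooted_in Z = vsum (fun v => #|[set i | tree_root (T i) == v]|) Z.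
Proof.
transitivity #|[set: 'I_k] :&: (fun i => tree_root (T i)) @^-1: Z|.
  by apply: eq_card => i; rewrite !inE.
by rewrite card_fiber; apply: eq_bigr => v _; apply: eq_card => i; rewrite !inE.
Qed.

Lemma rooted_inT : rooted_in setT = k.
Proof. by rewrite -[RHS]card_ord; apply: eq_card => i; rewrite !inE. Qed.

(** Trees through a common vertex have distinct root elements inside one basis. *)
Lemma roots_rank v (I : {set 'I_k}) Y : {in I, forall i, v \in tree_verts (T i)} ->
  {in I, forall i, tree_root (T i) \in Y} -> #|I| <= rk M (loc @^-1: Y).
Proof.
move=> vI IY; rewrite -(card_imset _ s_inj).
have /maxsetp iB := s_basis v.
rewrite -(eqP (_ : indep M (s @: I))).
  by apply: rkS; apply/subsetP=> t /imsetP[i iI ->]; rewrite inE s_loc IY.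
apply: indepS iB; apply/subsetP=> t /imsetP[i iI ->].
by apply: imset_f; rewrite inE /= vI.
Qed.

Lemma roots_at_rank v : #|[set i | tree_root (T i) == v]| <= rk M (loc @^-1: [set v]).
Proof.
by apply: (@roots_rank v) => i; rewrite !inE // => /eqP<-; apply: root_in_tree.
Qed.

(** Of the [r(S)] trees through a vertex of [X], each is rooted outside [X], in [Y] or in [X :\: Y];
    at most [r(S_Y)] of them are rooted in [Y]. *)
Lemma trees_into_lower X Y : X != set0 -> Y \subset X ->
  rk M setT <= trees_into X + rk M (loc @^-1: Y) + rooted_in (X :\: Y).
Proof.
case/set0Pn=> v vX sYX; pose I := [set i | v \in tree_verts (T i)].
have <- : #|I| = rk M setT.
  by rewrite -(basis_card (s_basis v)) card_imset //; apply: eq_card => i; rewrite !inE.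
pose I2 := [set i in I | tree_root (T i) \in Y].
have I2r : #|I2| <= rk M (loc @^-1: Y).
  by apply: (@roots_rank v) => i; rewrite !inE => /andP[].
apply: leq_trans (leq_add (leq_add (leqnn _) I2r) (leqnn _)).
rewrite /trees_into /rooted_in; set I1 := [set i | _ && _]; set I3 := [set i | _].
apply: (@leq_trans #|I1 :|: I2 :|: I3|); last first.
  apply: leq_trans (leq_card_setU _ _) _; rewrite leq_add2r; exact: leq_card_setU.
apply: subset_leq_card; apply/subsetP=> i; rewrite !inE /= => vi.
have -> : X :&: tree_verts (T i) != set0 by apply/set0Pn; exists v; rewrite inE vX.
by rewrite vi; have := subsetP sYX (tree_root (T i)); case: (_ \in Y) => /=; case: (_ \in X).
Qed.

(** Double counting: each tree has a crossing edge for every block it meets apart from its root's,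
    and the trees are edge-disjoint. *)
Lemma sum_trees_into P : partition P [set: V] ->
  \sum_(X in P) trees_into X <= cross_edges G P.
Proof.
move=> pP; pose C := [set e | pblock P (ends G e).1 != pblock P (ends G e).2].
have -> : \sum_(X in P) trees_into X =
    \sum_i #|[set X in P |
      (X :&: tree_verts (T i) != set0) && (tree_root (T i) \notin X)]|.
  transitivity (\sum_(X in P) \sum_i
      ((X :&: tree_verts (T i) != set0) && (tree_root (T i) \notin X) : nat)).
    apply: eq_bigr => X _; rewrite /trees_into -sum1_card big_mkcond /=.
    by apply: eq_bigr => i _; rewrite inE; case: (_ && _).
  rewrite exchange_big; apply: eq_bigr => i _ /=; rewrite -big_mkcondr sum1_card.
  by apply: eq_card => X; rewrite !inE.
apply: (@leq_trans (\sum_i #|[set e in tree_edges (T i) | e \in C]|)).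
  apply: leq_sum => i _; have : tree_root (T i) \in tree_verts (T i) by exact: root_in_tree.
  case: (T i) => U F v [sub con _] vU' /= vU.
  have := connected_cross pP sub con vU; congr (_ <= _).
  by apply: eq_card => e; rewrite !inE.
have -> : \sum_i #|[set e in tree_edges (T i) | e \in C]| =
    \sum_(e in C) \sum_i (e \in tree_edges (T i) : nat).
  rewrite exchange_big; apply: eq_bigr => i _ /=; rewrite -big_mkcondr sum1_card.
  by apply: eq_card => e; rewrite inE andbC.
rewrite /cross_edges -sum1_card; apply: leq_sum => e _.
have [/existsP[i ei]|/existsPn none] := boolP [exists i, e \in tree_edges (T i)]; last first.
  by rewrite big1 // => i _; rewrite (negbTE (none i)).
rewrite (bigD1 i) //= ei big1 // => j nji.
by apply/eqP; rewrite eqb0 (disjointFl (T_packing nji) ei).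
Qed.

End Necessity.

(** * From chosen roots to a packing *)

Section Sufficiency.
Variables (V E S : finType) (G : graph V E) (loc : S -> V) (M : matroid S).
Implicit Types (X Y : {set V}) (P : {set {set V}}).

Lemma rk_preim_sum Y Z :
  rk M (loc @^-1: (Y :|: Z)) <=
  rk M (loc @^-1: Y) + vsum (fun v => rk M (loc @^-1: [set v])) Z.
Proof.
have [n] := ubnP #|Z|; elim: n Z => // n IH Z ltZn.
have [->|/set0Pn[v vZ]] := eqVneq Z set0; first by rewrite setU0 leq_addr.
have := IH (Z :\ v); rewrite (cardsD1 v) vZ in ltZn => /(_ ltZn).
have := rkU M (loc @^-1: (Y :|: Z :\ v)) (loc @^-1: [set v]).
rewrite -preimsetU -setUA [Z :\ v :|: _]setUC setD1K //.
have sv : [set v] \subset Z by rewrite sub1set.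
by have := vsumD (fun v => rk M (loc @^-1: [set v])) sv; rewrite vsum1; lia.
Qed.

Lemma trees_from_roots k (R : {set S}) (m : V -> nat) :
    #|R| = k -> (forall v, indep M (R :&: loc @^-1: [set v])) ->
    vsum m setT <= inner G setT setT ->
    (forall X, X != set0 ->
      inner G setT X + rk M setT <= vsum m X + rk M (R :&: loc @^-1: X)) ->
  exists T : 'I_k -> rooted_tree G, [/\ is_packing T, matroid_based loc M T &
    forall v, #|[set i | tree_root (T i) == v]| = #|R :&: loc @^-1: [set v]|].
Proof.
move=> cR iR mE mR.
have [X||o oG oE] := @orientation V E G setT m.
- have [->|X0] := eqVneq X set0.
    by rewrite /inner (eq_card0 (A := [set _ in _ | _])) // => e; rewrite !inE.
  by have := mR X X0; have := rkS M (subsetT (R :&: loc @^-1: X)); lia.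
- by rewrite cardsT -(innerT G).
pose s (i : 'I_k) : S := enum_val (cast_ord (esym cR) i).
have s_inj : injective s by move=> i j /enum_val_inj/cast_ord_inj.
have sR i : s i \in R by apply: enum_valP.
have Rs t : t \in R -> exists i, t = s i.
  move=> tR; exists (cast_ord cR (enum_rank_in tR t)).
  by rewrite /s cast_ord_comp cast_ord_id enum_rankK_in.
have BE v : [set s i | i in 'I_k & v \in [set loc (s i)]] = R :&: loc @^-1: [set v].
  apply/setP=> t; apply/idP/idP => [/imsetP[i]|]; rewrite !inE.
    by move=> /= /eqP-> ->; rewrite sR eqxx.
  by case/andP=> /Rs[i ->] /eqP <-; apply: imset_f; rewrite !inE /=.
have cov : covering M o setT (fun v => [set s i | i in 'I_k & v \in [set loc (s i)]]).
  move=> X X0.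
  have -> : \bigcup_(v in X) [set s i | i in 'I_k & v \in [set loc (s i)]] = R :&: loc @^-1: X.
    apply/setP=> t; apply/bigcupP/idP => [[v vX]|]; rewrite ?BE !inE.
      by move=> /andP[-> /eqP->].
    by case/andP=> tR tX; exists (loc t); rewrite // BE !inE tR eqxx.
  have := mR X X0; have := oE X.
  (* At least [m(X)] heads lie in [X], so at least [m(X) - i(X) >= r(S) - r(R_X)] arcs enter [X]. *)
  suff -> : #|[set e in setT | (o e).2 \in X]| = entering o setT X + inner G setT X by lia.
  rewrite -(cardsID [set e | (o e).1 \in X]) addnC; congr (_ + _).
    by apply: eq_card => e; rewrite !inE andbC.
  apply: eq_card => e; rewrite !inE /=.
  by case: (joins_ends (oG e)) => -> //=; rewrite andbC.
have [i|i|i j _|i|v||U [A [tU rU dA bU]]] :=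
  @grow_trees V E G S M o k s (fun i => loc (s i)) oG setT
    (fun i => [set loc (s i)]) (fun=> set0).
- exact: is_tree1.
- exact: set11.
- by rewrite -setI_eq0 set0I.
- by rewrite -setI_eq0 setI0.
- by rewrite BE.
- exact: cov.
exists (fun i => RootedTree (tU i) (rU i)); split=> //; first by exists s.
move=> v; rewrite -BE card_imset //; apply: eq_card => i.
by rewrite !inE eq_sym.
Qed.

End Sufficiency.

(** * Both implications put together *)

Theorem theorem9 (V E S : finType) (G : graph V E) (loc : S -> V) (k : nat)
    (f g : V -> nat) (M : matroid S) :
  (exists T : 'I_k -> rooted_tree G,
     [/\ is_packing T, matroid_based loc M T & bounded f g T])
  <->
  [/\ forall v : V, f v <= minn (rk M (loc @^-1: [set v])) (g v),
      k <= \sum_(v : V) minn (rk M (loc @^-1: [set v])) (g v),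
      forall P : {set {set V}}, partition P [set: V] ->
        (\sum_(X in P) max_subset X (fun Y =>
            (rk M [set: S])%:Z - (rk M (loc @^-1: Y))%:Z
              - (vsum g (X :\: Y))%:Z)
         <= (cross_edges G P)%:Z)%R
    & forall P : {set {set V}}, partition P [set: V] ->
        (\sum_(X in P) max_subset X (fun Y =>
            (rk M [set: S])%:Z - (rk M (loc @^-1: Y))%:Z + (vsum f Y)%:Z)
         <= (cross_edges G P)%:Z + k%:Z)%R].
Proof.
split=> [[T [pT [s [s_inj s_loc sB]] bT]]|[fu ku condg condf]].
  have rho_u v : #|[set i | tree_root (T i) == v]| <= minn (rk M (loc @^-1: [set v])) (g v).
    by rewrite leq_min (roots_at_rank s_inj s_loc sB); case/andP: (bT v).
  have X0 P X : partition P [set: V] -> X \in P -> X != set0.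
    by case/and3P=> _ _ n0 XP; apply: contraNneq n0 => <-.
  split=> [v||P pP|P pP].
  - by apply: leq_trans (rho_u v); case/andP: (bT v).
  - by rewrite -[leqLHS](rooted_inT T) rooted_inE vsumT; apply: leq_sum => v _.
  - apply: (@le_trans _ _ (\sum_(X in P) trees_into T X)%N%:Z%R);
      last by have := sum_trees_into pT pP; lia.
    apply: sum_max_le => X Y XP sYX; have := trees_into_lower s_inj s_loc sB (X0 P X pP XP) sYX.
    have : rooted_in T (X :\: Y) <= vsum g (X :\: Y).
      by rewrite rooted_inE; apply: leq_vsum => v _; case/andP: (bT v).
    lia.
  (* For (iv) all roots inside a block are counted too; over the partition they number [k]. *)
  apply: (@le_trans _ _ (\sum_(X in P) (trees_into T X + rooted_in T X))%N%:Z%R); last first.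
    rewrite -PoszD lez_nat big_split; apply: leq_add; first exact: sum_trees_into.
    apply: eq_leq.
    rewrite -[RHS](rooted_inT T) rooted_inE -(partition_sum _ pP).
    by apply: eq_bigr => X _; rewrite rooted_inE.
  apply: sum_max_le => X Y XP sYX; have := trees_into_lower s_inj s_loc sB (X0 P X pP XP) sYX.
  have : vsum f Y <= rooted_in T Y.
    by rewrite rooted_inE; apply: leq_vsum => v _; case/andP: (bT v).
  have := vsumD (fun v => #|[set i | tree_root (T i) == v]|) sYX; rewrite -!rooted_inE; lia.
pose q (Y : {set V}) := rk M (loc @^-1: Y); pose r := rk M setT.
(* [u] bounds the number of roots at a vertex; it is the rank on [W] and [g] elsewhere. *)
pose u (v : V) := minn (q [set v]) (g v); pose W := [set v | q [set v] <= g v].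
have q_submod (X Y : {set V}) : q (X :|: Y) + q (X :&: Y) <= q X + q Y.
  by rewrite /q preimsetU preimsetI; apply: rkUI.
have q_le (X : {set V}) : q X <= r by apply: rkS; apply: subsetT.
have i_super := inner_supermod G setT.
(* Moving the part of [W] in [X :\: Y] into [Y] raises the rank by at most its [u]-sum, and [u = g]
   on what remains; so (iii) with [g] yields its analogue with [u]. *)
have ug (X Y : {set V}) : Y \subset X ->
    q (Y :|: (X :\: Y) :&: W) + vsum g (X :\: (Y :|: (X :\: Y) :&: W)) <= q Y + vsum u (X :\: Y).
  move=> sYX; rewrite -setDDl.
  have := vsumD u (subsetIl (X :\: Y) W).
  have : q (Y :|: (X :\: Y) :&: W) <= q Y + vsum u ((X :\: Y) :&: W).
    apply: leq_trans (rk_preim_sum loc M _ _) _; rewrite leq_add2l.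
    by apply: leq_vsum => v; rewrite !inE /u /q => /andP[_]; lia.
  have -> : vsum g (X :\: Y :\: (X :\: Y) :&: W) = vsum u (X :\: Y :\: (X :\: Y) :&: W).
    apply: eq_bigr => v; rewrite !inE /u; case: (v \in Y); case: (v \in X) => //=; lia.
  lia.
have [P y pP sy|m fe mE] := @feasible_exists V (inner G setT) q r i_super q_submod q_le u.
  pose z X := y X :|: (X :\: y X) :&: W.
  have sz : {in P, forall X, z X \subset X}.
    by move=> X XP; rewrite subUset sy //= subIset // subsetDl.
  have le1 : \sum_(X in P) r <= cross_edges G P + \sum_(X in P) (q (z X) + vsum g (X :\: z X)).
    by apply: sum_le_max (condg P pP) sz _ => X _; rewrite PoszD opprD addrA.
  have le2 : \sum_(X in P) (q (z X) + vsum g (X :\: z X)) <=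
      \sum_(X in P) (q (y X) + vsum u (X :\: y X)).
    by apply: leq_sum => X XP; apply: ug; apply: sy.
  (* All edges are the crossing ones plus those inside blocks; the latter cancel. *)
  rewrite big_split /= innerT -(inner_cross G pP) -addnA leq_add2l.
  by apply: leq_trans le1 _; rewrite leq_add2l.
have fu' v : f v <= u v by exact: fu.
have ku' : k <= vsum u setT by rewrite vsumT.
have [P y pP sy|m' [x [fe' mE' fxu xk]]] :=
    feasible_reduce i_super q_submod q_le fe mE fu' ku'.
  have condf' : (\sum_(X in P) max_subset X (fun Y =>
      r%:Z - (q Y)%:Z + (vsum f Y)%:Z) <= (cross_edges G P + k)%N%:Z)%R.
    by rewrite PoszD; exact: condf.
  have le : \sum_(X in P) (r + vsum f (y X)) <= cross_edges G P + k + \sum_(X in P) q (y X).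
    by apply: sum_le_max condf' sy _ => X _; rewrite PoszD addrAC.
  rewrite (eq_bigr (fun X => inner G setT X + (r + vsum f (y X)))) => [|X _]; last by rewrite addnA.
  by rewrite [leqLHS]big_split /= innerT -(inner_cross G pP) -!addnA leq_add2l addnA.
have xle v : x v <= rk M (loc @^-1: [set v]) by have := fxu v; rewrite /u /q; lia.
have [R [cR iR mR]] := select_roots i_super fe' xle.
have kR : #|R| = k.
  by rewrite -(setIT R) -(preimsetT loc) card_fiber -xk; apply: eq_bigr => v _.
have [T [pT bT rT]] := trees_from_roots kR iR mE' mR.
by exists T; split=> // v; rewrite rT cR; have := fxu v; rewrite /u; lia.
Qed.
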